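(* Let $L$ be a $1$-bounded, one-sorted metric signature and let $M$ be an $\omega$-saturated, strongly pseudofinite $L$-structure. Let $f\colon M\to M$ be a formula-definable function. If $f$ is surjective, then $f$ is injective.
   Context: Continuous first-order logic for metric structures (Ben Yaacov–Berenstein–Henson–Usvyatsov) is used. For a $1$-bounded one-sorted metric signature $L$, $L$-structures are complete metric spaces of diameter at most $1$ with interpretations of constant, function and $[0,1]$-valued predicate symbols, each function and predicate symbol obeying a modulus of uniform continuity specified by $L$. Connectives are all continuous functions $[0,1]^n\to[0,1]$, quantifiers are $\sup$ and $\inf$. The value of a sentence $\sigma$ in $M$ is $\sigma^M\in[0,1]$. A structure is finite if its underlying set is. $M$ is $\omega$-saturated if every set of conditions (of the form $\varphi(x)=0$, $x$ a finite tuple) with parameters from a finite subset of $M$ all of whose finite subsets are realized in $M$ is realized in $M$. $M$ is strongly pseudofinite if for every $L$-sentence $\sigma$ with $\sigma^M=0$ there is a finite $L$-structure $A$ with $\sigma^A=0$. $f\colon M\to M$ is formula-definable if there are an $L$-formula $\varphi(x,y,z)$, with $z$ a (finite) tuple of variables, and a tuple $a$ from $M$ such that $d(f(x),y)=\varphi^M(x,y,a)$ for all $x,y\in M$. *)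

(* Defs.v *)
From HB Require Import structures.
From mathcomp Require Import all_boot all_order all_algebra.
From mathcomp Require Import boolp classical_sets cardinality reals topology.
From mathcomp Require Import normedtype.

Set Implicit Arguments.
Unset Strict Implicit.
Unset Printing Implicit Defensive.

Import Order.TTheory GRing.Theory Num.Theory.
Import numFieldNormedType.Exports.

Local Open Scope classical_set_scope.
Local Open Scope ring_scope.

(* The library's complete spaces are pointed, so these are the nonempty
   complete metric spaces. *)
#[short(type="completeMetricType")]
HB.structure Definition CompleteMetric (R : realType) :=
  {T of CompletePseudoMetric R T & Metric R T}.

(* Only the values of [modf] on (0,1] matter. *)
Record modulus (R : realType) := Modulus {
  modf :> R -> R;
  modulus_bounds : forall e : R, 0 < e <= 1 -> 0 < modf e <= 1 }.

Record signature (R : realType) := Signature {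
  const_symb : Type;
  fun_symb : Type;
  pred_symb : Type;
  fun_arity : fun_symb -> nat;
  pred_arity : pred_symb -> nat;
  fun_modulus : fun_symb -> modulus R;
  pred_modulus : pred_symb -> modulus R }.

(* Finite powers carry the maximum metric, so [d(x,y) < D e] for tuples is a
   coordinatewise condition. *)
Record structure (R : realType) (L : signature R) := Structure {
  carrier :> completeMetricType R;
  diam_le1 : forall x y : carrier, mdist x y <= 1;
  const_int : const_symb L -> carrier;
  fun_int : forall s : fun_symb L, ('I_(fun_arity s) -> carrier) -> carrier;
  pred_int : forall s : pred_symb L, ('I_(pred_arity s) -> carrier) -> R;
  pred_int01 : forall (s : pred_symb L) x, 0 <= @pred_int s x <= 1;
  fun_int_unif : forall (s : fun_symb L) (e : R), 0 < e <= 1 ->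
    forall x y : 'I_(fun_arity s) -> carrier,
      (forall i, mdist (x i) (y i) < fun_modulus s e) ->
      mdist (@fun_int s x) (@fun_int s y) <= e;
  pred_int_unif : forall (s : pred_symb L) (e : R), 0 < e <= 1 ->
    forall x y : 'I_(pred_arity s) -> carrier,
      (forall i, mdist (x i) (y i) < pred_modulus s e) ->
      `|@pred_int s x - @pred_int s y| <= e }.
Arguments fun_int {R L} M s x : rename.
Arguments pred_int {R L} M s x : rename.

Definition cube (R : realType) n : set 'rV[R]_n :=
  [set v | forall i, 0 <= v ord0 i <= 1].

(* Continuous functions [0,1]^n -> [0,1]; values off the cube are irrelevant. *)
Record connective (R : realType) (n : nat) := Connective {
  conn_fun :> 'rV[R]_n -> R;
  conn01 : forall v : 'rV[R]_n, cube v -> 0 <= conn_fun v <= 1;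
  conn_continuous : {within @cube R n, continuous conn_fun} }.

Section Syntax.
Context {R : realType} (L : signature R).

Inductive term (n : nat) : Type :=
| Var of 'I_n
| Const of const_symb L
| App (s : fun_symb L) of ('I_(fun_arity s) -> term n).

(* [formula n] has its free variables indexed by ['I_n]; the quantifiers bind
   variable [0] and shift the others. *)
Inductive formula (n : nat) : Type :=
| FDist of term n & term n
| FPred (s : pred_symb L) of ('I_(pred_arity s) -> term n)
| FConn m of connective R m & ('I_m -> formula n)
| FSup of formula n.+1
| FInf of formula n.+1.

Definition sentence := formula 0.

End Syntax.

Definition tcons (T : Type) n (x : T) (v : 'I_n -> T) : 'I_n.+1 -> T :=
  fun i => if unlift ord0 i is Some j then v j else x.

Definition tcat (T : Type) m n (v : 'I_m -> T) (w : 'I_n -> T) :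
    'I_(m + n) -> T :=
  fun i => match split i with inl j => v j | inr j => w j end.

Definition tnil (T : Type) : 'I_0 -> T :=
  fun i => match notF (ltn_ord i) with end.

Section Semantics.
Context {R : realType} {L : signature R} (M : structure L).

Fixpoint teval n (v : 'I_n -> M) (t : term L n) : M :=
  match t with
  | Var i => v i
  | Const c => const_int M c
  | App s a => fun_int M s (fun i => teval v (a i))
  end.

Fixpoint feval n (v : 'I_n -> M) (phi : formula L n) {struct phi} : R :=
  match phi with
  | FDist t u => mdist (teval v t) (teval v u)
  | FPred s a => pred_int M s (fun i => teval v (a i))
  | FConn m u a => u (\row_i feval v (a i))
  | FSup psi => sup (range (fun x : M => feval (tcons x v) psi))
  | FInf psi => inf (range (fun x : M => feval (tcons x v) psi))
  end.

Definition sentence_value (sigma : sentence L) : R := feval (@tnil M) sigma.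

Definition finite_structure := finite_set [set: M].

(* [Condition phi b] is the condition [phi(x,b) = 0] on [n]-tuples [x]. *)
Record condition (n : nat) := Condition {
  cond_nparams : nat;
  cond_formula : formula L (n + cond_nparams)%N;
  cond_params : 'I_cond_nparams -> M }.
Arguments cond_params {n} c i.

Definition params_in n (A : set M) (c : condition n) :=
  forall i, A (cond_params c i).

Definition satisfies n (x : 'I_n -> M) (c : condition n) :=
  feval (tcat x (cond_params c)) (cond_formula c) = 0.

Definition realized n (Sigma : set (condition n)) :=
  exists x : 'I_n -> M, forall c, Sigma c -> satisfies x c.

Definition omega_saturated :=
  forall (A : set M) n (Sigma : set (condition n)),
    finite_set A -> Sigma `<=` params_in A ->
    (forall Sigma0 : set (condition n),
        finite_set Sigma0 -> Sigma0 `<=` Sigma -> realized Sigma0) ->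
    realized Sigma.

Definition formula_definable (f : M -> M) :=
  exists k (phi : formula L k.+2) (a : 'I_k -> M),
    forall x y : M, mdist (f x) y = feval (tcons x (tcons y a)) phi.

End Semantics.

Definition strongly_pseudofinite (R : realType) (L : signature R)
    (M : structure L) :=
  forall sigma : sentence L, sentence_value M sigma = 0 ->
    exists A : structure L,
      finite_structure A /\ sentence_value A sigma = 0.

(* Main.v *)
Require Import Defs.
From mathcomp Require Import all_boot all_order all_algebra.
From mathcomp Require Import reals.
From mathcomp Require Import boolp classical_sets cardinality topology normedtype lra.

(** Non-injectivity is witnessed at a definite scale: [f b = f c] with
    [d(b,c) >= r > 0].  If [phi(x,y,a)] defines the distance to the graph of [f],
    then "some parameters [a] make [phi] the graph distance of a surjective
    function identifying two points at distance at least [r]" is expressed by a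
    single sentence with value [0] in [M].  It then has value [0] in some finite
    structure, where infima over elements are attained, so that a finite set would
    carry a surjective non-injective self-map. *)

Set Implicit Arguments.
Unset Strict Implicit.
Unset Printing Implicit Defensive.

Import Order.TTheory GRing.Theory Num.Theory.
Import numFieldNormedType.Exports.

Local Open Scope classical_set_scope.
Local Open Scope ring_scope.

(** * Surjective self-maps of finite sets *)

Lemma finite_surj_inj (T : choiceType) (g : T -> T) :
  finite_set [set: T] -> (forall y, exists x, g x = y) -> injective g.
Proof.
move=> /finite_seqP[s sT] gsurj.
have ins x : x \in undup s.
  by rewrite mem_undup; have : [set: T] x by []; rewrite sT.
(* By surjectivity the image list contains every entry of [undup s], and it has the same length, so
   it cannot repeat. *)
have /(_ (undup_uniq s)) : uniq (undup s) -> uniq (map g (undup s)).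
  move=> us; apply: (leq_size_uniq us); last by rewrite size_map.
  by move=> y _; have [x <-] := gsurj y; apply: map_f.
move=> ugs x y gxy.
have szi z : (index z (undup s) < size (undup s))%N by rewrite index_mem.
(* In a list without repetition equal entries have equal positions, so [x] and [y] have the same
   index in [undup s]. *)
have := nth_uniq (g x) _ _ ugs.
move=> /(_ (index x (undup s)) (index y (undup s))).
rewrite size_map !szi => /(_ isT isT).
rewrite !(nth_map x) // !nth_index // gxy eqxx => /esym/eqP ixy.
by rewrite -(nth_index x (ins x)) ixy nth_index.
Qed.

(** * Extending assignments and renaming variables *)

Section TupleCons.
Context {T : Type}.

Lemma tcons0 n (x : T) (v : 'I_n -> T) : tcons x v ord0 = x.
Proof. by rewrite /tcons unlift_none. Qed.

Lemma tconsS n (x : T) (v : 'I_n -> T) i : tcons x v (lift ord0 i) = v i.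
Proof. by rewrite /tcons liftK. Qed.

Lemma comp_tcons U n (h : T -> U) (x : T) (v : 'I_n -> T) :
  h \o tcons x v = tcons (h x) (h \o v).
Proof. by apply: funext => i; rewrite /tcons /=; case: unlift. Qed.

Lemma tcons_lift n (x : T) (v : 'I_n -> T) : tcons x v \o lift ord0 = v.
Proof. by apply: funext => i /=; rewrite tconsS. Qed.

Lemma tcons_eta n (v : 'I_n.+1 -> T) : tcons (v ord0) (v \o lift ord0) = v.
Proof. by apply: funext => i; rewrite /tcons; case: unliftP => [j|] ->. Qed.

Lemma tnil_eta (v : 'I_0 -> T) : v = tnil T.
Proof. by apply: funext => -[]. Qed.

End TupleCons.

Section Renaming.
Context {R : realType} {L : signature R}.

Fixpoint trename m n (rho : 'I_m -> 'I_n) (t : term L m) : term L n :=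
  match t with
  | Var i => Var L (rho i)
  | Const c => Const n c
  | App s a => App (fun i => trename rho (a i))
  end.

(** Under a quantifier the bound variable 0 stays fixed, and the other variables follow the shifted
    [rho]. *)
Definition lift_renaming m n (rho : 'I_m -> 'I_n) : 'I_m.+1 -> 'I_n.+1 :=
  tcons ord0 (lift ord0 \o rho).

Fixpoint frename m n (rho : 'I_m -> 'I_n) (p : formula L m) {struct p} :
    formula L n :=
  match p with
  | FDist t u => FDist (trename rho t) (trename rho u)
  | FPred s a => FPred (fun i => trename rho (a i))
  | FConn k u a => FConn u (fun i => frename rho (a i))
  | FSup q => FSup (frename (lift_renaming rho) q)
  | FInf q => FInf (frename (lift_renaming rho) q)
  end.

Lemma tcons_lift_renaming T m n (rho : 'I_m -> 'I_n) (x : T) v :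
  tcons x v \o lift_renaming rho = tcons x (v \o rho).
Proof. by rewrite comp_tcons tcons0 compA tcons_lift. Qed.

Context (M : structure L).

Lemma teval_rename m n (rho : 'I_m -> 'I_n) (v : 'I_n -> M) t :
  teval v (trename rho t) = teval (v \o rho) t.
Proof.
elim: t => //= s a IH; congr (fun_int M s _).
by apply: funext => i; exact: IH.
Qed.

Lemma feval_rename m n (rho : 'I_m -> 'I_n) (v : 'I_n -> M) p :
  feval v (frename rho p) = feval (v \o rho) p.
Proof.
elim: p n rho v => {m} [m t u|m s a|m k u a IH|m q IH|m q IH] n rho v /=.
- by rewrite !teval_rename.
- by congr (pred_int M s _); apply: funext => i; rewrite teval_rename.
- by congr (u _); apply/rowP => i; rewrite !mxE.
- congr (sup _); apply: eq_imagel => x _.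
  by rewrite IH tcons_lift_renaming.
- congr (inf _); apply: eq_imagel => x _.
  by rewrite IH tcons_lift_renaming.
Qed.

End Renaming.

(** * Connectives for combining conditions *)

Section Connectives.
Context {R : realType}.

Program Definition max_conn : connective R 2 :=
  @Connective R 2 (fun v => Num.max (v ord0 ord0) (v ord0 ord_max)) _ _.
Next Obligation.
move=> v cv; have /andP[a b] := cv ord0; have /andP[c d] := cv ord_max.
by rewrite le_max ge_max a b d.
Qed.
Next Obligation.
apply: continuous_subspaceT => v.
by apply: continuous_max; exact: coord_continuous.
Qed.

Program Definition dist_conn : connective R 2 :=
  @Connective R 2 (fun v => `|v ord0 ord0 - v ord0 ord_max|) _ _.
Next Obligation.
move=> v cv; have /andP[a b] := cv ord0; have /andP[c d] := cv ord_max.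
by rewrite normr_ge0 /= ler_norml; lra.
Qed.
Next Obligation.
apply: continuous_subspaceT => v.
apply: (cvg_norm (F := nbhs v)).
by apply: (cvgB (F := nbhs v)); exact: coord_continuous.
Qed.

(** Truncated subtraction from [r]; the bound [r <= 1] keeps its values in the unit interval. *)
Program Definition sub_conn (r : R) (r1 : r <= 1) : connective R 1 :=
  @Connective R 1 (fun v => Num.max 0 (r - v ord0 ord0)) _ _.
Next Obligation.
move=> r r1 v cv; have /andP[a b] := cv ord0.
by rewrite le_max lexx ge_max ler01 lerBlDr (le_trans r1) // lerDl.
Qed.
Next Obligation.
move=> r r1; apply: continuous_subspaceT => v.
refine (continuous_max (f := fun=> 0) (g := fun w : 'rV_1 => r - w ord0 ord0) _ _).
  exact: cst_continuous.
by apply: (cvgB (F := nbhs v)); [exact: cvg_cst|exact: coord_continuous].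
Qed.

Context {L : signature R}.

(** With value 0 read as truth, [FMax] acts as conjunction, [FEq] as equality of values and [FGeq]
    as a lower bound. *)
Definition FMax n (p q : formula L n) :=
  FConn max_conn (fun i => if i == ord0 then p else q).

Definition FEq n (p q : formula L n) :=
  FConn dist_conn (fun i => if i == ord0 then p else q).

Definition FGeq r (r1 : r <= 1) n (p : formula L n) :=
  FConn (sub_conn r1) (fun=> p).

End Connectives.

(** * Formulas of value 0, and attained infima in finite structures *)

Section Vanishing.
Context {R : realType} {L : signature R} (M : structure L).

(** In the quantifier cases the range is nonempty because carriers are pointed, and bounded by
    induction, so [sup] and [inf] are genuine extremal bounds rather than default values. *)
Lemma feval_itv n (v : 'I_n -> M) (p : formula L n) : 0 <= feval v p <= 1.
Proof.
elim: p v => {n} [n t u|n s a|n k u a IH|n q IH|n q IH] v /=.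
- by rewrite mdist_ge0 diam_le1.
- exact: pred_int01.
- by apply: conn01 => i; rewrite mxE.
- have ne : range (fun x : M => feval (tcons x v) q) (feval (tcons point v) q).
    by exists point.
  have ub : ubound (range (fun x : M => feval (tcons x v) q)) 1.
    by move=> _ [x _ <-]; have /andP[] := IH (tcons x v).
  apply/andP; split; last by apply: ge_sup ub; exists (feval (tcons point v) q).
  apply: le_trans (ub_le_sup _ ne); last by exists 1.
  by have /andP[] := IH (tcons point v).
- have ne : range (fun x : M => feval (tcons x v) q) (feval (tcons point v) q).
    by exists point.
  have lb : lbound (range (fun x : M => feval (tcons x v) q)) 0.
    by move=> _ [x _ <-]; have /andP[] := IH (tcons x v).
  apply/andP; split; first by apply: lb_le_inf lb; exists (feval (tcons point v) q).
  apply: le_trans (ge_inf _ ne) _; first by exists 0.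
  by have /andP[] := IH (tcons point v).
Qed.

Lemma feval_ge0 n (v : 'I_n -> M) (p : formula L n) : 0 <= feval v p.
Proof. by have /andP[] := feval_itv v p. Qed.

Lemma feval_le1 n (v : 'I_n -> M) (p : formula L n) : feval v p <= 1.
Proof. by have /andP[] := feval_itv v p. Qed.

Lemma feval_max0 n (v : 'I_n -> M) (p q : formula L n) :
  feval v (FMax p q) = 0 <-> feval v p = 0 /\ feval v q = 0.
Proof.
rewrite /= !mxE /=; split=> [pq0|[-> ->]]; last by rewrite maxxx.
by split; apply/eqP; rewrite eq_le feval_ge0 andbT -pq0 le_max lexx ?orbT.
Qed.

Lemma feval_eq0 n (v : 'I_n -> M) (p q : formula L n) :
  feval v (FEq p q) = 0 <-> feval v p = feval v q.
Proof.
rewrite /= !mxE /=; split=> [/eqP|->]; last by rewrite subrr normr0.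
by rewrite normr_eq0 subr_eq0 => /eqP.
Qed.

Lemma feval_geq0 r (r1 : r <= 1) n (v : 'I_n -> M) (p : formula L n) :
  feval v (FGeq r1 p) = 0 <-> r <= feval v p.
Proof. by rewrite /= mxE -subr_le0; split=> [/max_idPl|/max_idPl]. Qed.

Lemma feval_sup0 n (v : 'I_n -> M) (p : formula L n.+1) :
  feval v (FSup p) = 0 <-> forall x : M, feval (tcons x v) p = 0.
Proof.
split=> [p0 x|p0]; apply/eqP; rewrite eq_le feval_ge0 andbT.
  rewrite -p0; apply: ub_le_sup; last by exists x.
  by exists 1 => _ [y _ <-]; exact: feval_le1.
apply: ge_sup; first by exists (feval (tcons point v) p); exists point.
by move=> _ [x _ <-]; have /eqP := p0 x; rewrite eq_le => /andP[].
Qed.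

(** Only this direction holds in general: an infimum may vanish without being attained. *)
Lemma feval_inf0 n (v : 'I_n -> M) (p : formula L n.+1) :
  (exists x : M, feval (tcons x v) p = 0) -> feval v (FInf p) = 0.
Proof.
move=> [x px]; apply/eqP; rewrite eq_le feval_ge0 andbT -px.
by apply: ge_inf; [exists 0 => _ [y _ <-]; exact: feval_ge0|exists x].
Qed.

(** A sentence cannot mention parameters from a structure, so they become variables bound by infima,
    an approximate existential quantification. *)
Fixpoint inf_closure n : formula L n -> sentence L :=
  if n is m.+1 then fun p => inf_closure (FInf p) else id.

Lemma inf_closure0 n (v : 'I_n -> M) (p : formula L n) :
  feval v p = 0 -> sentence_value M (inf_closure p) = 0.
Proof.
elim: n v p => [|n IH] v p p0 /=; first by rewrite /sentence_value -(tnil_eta v).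
apply: (IH (v \o lift ord0)); apply: feval_inf0; exists (v ord0).
by rewrite tcons_eta.
Qed.

Context (finM : finite_structure M).

Lemma finite_feval_inf0 n (v : 'I_n -> M) (p : formula L n.+1) :
  feval v (FInf p) = 0 <-> exists x : M, feval (tcons x v) p = 0.
Proof.
split=> [p0|]; last exact: feval_inf0.
have /finite_seqP[s sM] := finM.
pose F x := feval (tcons x v) p.
have [x Fx] : exists x, forall y, F x <= F y.
  (* Induction on the enumeration keeps a minimizer over the entries seen; for the empty list any
     point serves. *)
  suff [x Fx] : exists x, forall y, y \in s -> F x <= F y.
    by exists x => y; apply: Fx; have : [set: M] y by []; rewrite sM.
  elim: {sM} s => [|z s [x Fx]]; first by exists point.
  have [Fzx|Fxz] := leP (F z) (F x); [exists z|exists x] => y.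
    by rewrite inE => /predU1P[->//|/Fx]; exact: le_trans.
  by rewrite inE => /predU1P[->|/Fx//]; exact: ltW.
exists x; apply/eqP; rewrite eq_le feval_ge0 andbT -p0.
by apply: lb_le_inf => [|_ [y _ <-]]; [exists (F x); exists x|exact: Fx].
Qed.

Lemma finite_inf_closure0 n (p : formula L n) :
  sentence_value M (inf_closure p) = 0 -> exists v : 'I_n -> M, feval v p = 0.
Proof.
elim: n p => [|n IH] p /=; first by exists (@tnil M).
by move=> /IH[v /finite_feval_inf0[x px]]; exists (tcons x v).
Qed.

End Vanishing.

(** * The sentence describing a non-injective surjection *)

Section NonInjectiveSurjection.
Context {R : realType} {L : signature R} (k : nat).
Implicit Types (phi : formula L k.+2) (M : structure L).

(* In the scope of three quantifiers the innermost variable is [0] and the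
   parameters start at [3]; [graph_at i phi] is [phi(x_i, x_0, a)]. *)
Definition graph_at (i : 'I_k.+3) phi : formula L k.+3 :=
  frename (tcons i (tcons ord0 (lift ord0 \o (lift ord0 \o lift ord0)))) phi.

Let x1 : 'I_k.+3 := lift ord0 ord0.
Let x2 : 'I_k.+3 := lift ord0 (lift ord0 ord0).

(** Write [x], [y], [z] for [x2], [x1] and variable 0. Value 0 says, up to attainment of the infimum
    over [y], that [phi(x,z,a)] is the distance from [z] to a single point [y]. *)
Definition functional phi : formula L k :=
  FSup (FInf (FSup (FEq (graph_at x2 phi) (FDist (Var L x1) (Var L ord0))))).

Definition onto phi : formula L k := FSup (FInf phi).

(** Variable 0 is the common image of [x2] and [x1]: the value of the map is not a term, so it gets
    its own quantifier. *)
Definition identifies r (r1 : r <= 1) phi : formula L k :=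
  FInf (FInf (FInf (FMax (FMax (graph_at x2 phi) (graph_at x1 phi))
                         (FGeq r1 (FDist (Var L x2) (Var L x1)))))).

Lemma feval_graph_at M phi i (v : 'I_k -> M) (x y z : M) :
  feval (tcons z (tcons y (tcons x v))) (graph_at i phi) =
  feval (tcons (tcons z (tcons y (tcons x v)) i) (tcons z v)) phi.
Proof. by rewrite feval_rename !comp_tcons tcons0 !compA !tcons_lift. Qed.

Definition noninjective_surjection r (r1 : r <= 1) phi : sentence L :=
  inf_closure (FMax (FMax (functional phi) (onto phi)) (identifies r1 phi)).

(** All infima are attained: at [a], at [f x], at a preimage of [y], and at [b], [c], [f b]. The
    scale is [d(b,c)] itself, so the distance requirement holds with equality. *)
Lemma noninjective_surjection0 M phi (a : 'I_k -> M) (f : M -> M) (b c : M)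
    (r1 : mdist b c <= 1) :
  (forall x y, mdist (f x) y = feval (tcons x (tcons y a)) phi) ->
  (forall y, exists x, f x = y) -> f b = f c ->
  sentence_value M (noninjective_surjection r1 phi) = 0.
Proof.
move=> fphi fsurj fbc; apply: (@inf_closure0 _ _ _ _ a).
apply/feval_max0; split; [apply/feval_max0; split|].
- apply/feval_sup0 => x; apply/feval_inf0; exists (f x).
  apply/feval_sup0 => z; apply/feval_eq0.
  by rewrite feval_graph_at /= !(tcons0, tconsS) fphi.
- apply/feval_sup0 => y; apply/feval_inf0; have [x fxy] := fsurj y.
  by exists x; rewrite -fphi fxy mdistxx.
- apply/feval_inf0; exists b; apply/feval_inf0; exists c.
  apply/feval_inf0; exists (f b).
  apply/feval_max0; split; first apply/feval_max0.
    rewrite !feval_graph_at !(tcons0, tconsS) -!fphi -fbc.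
    by rewrite mdistxx.
  by apply/feval_geq0; rewrite /= !(tcons0, tconsS).
Qed.

(** Attained infima make the approximate statements exact: [functional] yields a map [g], [onto]
    makes it surjective, hence injective by finiteness, and [identifies] gives two points with the
    same image at distance at least [r > 0]. *)
Lemma finite_noninjective_surjection A phi r (r1 : r <= 1) : 0 < r ->
  finite_structure A -> sentence_value A (noninjective_surjection r1 phi) <> 0.
Proof.
move=> r0 finA /(finite_inf_closure0 finA)[a].
move=> /feval_max0[/feval_max0[/feval_sup0 phifun /feval_sup0 phionto]].
move=> /(finite_feval_inf0 finA)[b] /(finite_feval_inf0 finA)[c].
move=> /(finite_feval_inf0 finA)[w] /feval_max0[/feval_max0[]].
rewrite !feval_graph_at !(tcons0, tconsS) => phib phic.
move=> /feval_geq0; rewrite /= !(tcons0, tconsS) => rbc.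
have [g gphi] : {g : A -> A & forall x y,
    feval (tcons x (tcons y a)) phi = mdist (g x) y}.
  (* The point where the infimum vanishes depends on [x]; choice collects these points into a
     map. *)
  apply: (@choice _ _ (fun x y => forall z,
    feval (tcons x (tcons z a)) phi = mdist y z)) => x.
  have /(finite_feval_inf0 finA)[y /feval_sup0 xy] := phifun x.
  exists y => z; have /feval_eq0 := xy z.
  by rewrite feval_graph_at /= !(tcons0, tconsS).
have ginj : injective g.
  apply: (finite_surj_inj finA) => y.
  have /(finite_feval_inf0 finA)[x] := phionto y.
  by rewrite gphi => /mdist_positivity gxy; exists x.
move: phib phic; rewrite !gphi => /mdist_positivity gb /mdist_positivity gc.
have bc : b = c by apply: ginj; rewrite gb gc.
by move: rbc; rewrite bc mdistxx leNgt r0.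
Qed.

End NonInjectiveSurjection.

Theorem proposition6p3 (R : realType) (L : signature R) (M : structure L)
    (f : M -> M) :
  omega_saturated M -> strongly_pseudofinite M -> formula_definable f ->
  (forall y : M, exists x : M, f x = y) ->
  injective f.
Proof.
move=> _ psf [k [phi [a fphi]]] fsurj b c fbc.
apply: contrapT => /eqP bc.
(* The scale [d(b,c)] is at most 1 by the diameter bound and positive since [b] and [c] differ. *)
have /psf[A [finA]] := noninjective_surjection0 (diam_le1 b c) fphi fsurj fbc.
by apply: finite_noninjective_surjection finA; rewrite mdist_gt0.
Qed.
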